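(* Let $\mathbb{X}$ be a Cartesian difference category with infinitesimal extension $\varepsilon$ and difference combinator $\boldsymbol\partial$. Define $\mathsf{T}:\mathbb{X}\to\mathbb{X}$ by $\mathsf{T}(A)=A\times A$ and $\mathsf{T}(f)=\langle f\circ\pi_0,\boldsymbol\partial[f]\rangle$, and for each object $A$ define $$\eta_A=\langle 1_A,0\rangle:A\to\mathsf{T}(A),\qquad \mu_A=\langle\pi_{00},\ \pi_{10}+\pi_{01}+\varepsilon(\pi_{11})\rangle:\mathsf{T}^2(A)\to\mathsf{T}(A),$$ where $\pi_{ij}=\pi_i\circ\pi_j$. Then $(\mathsf{T},\mu,\eta)$ is a monad on $\mathbb{X}$ (that is, $\mathsf{T}$ is a functor, $\mu$ and $\eta$ are natural transformations, and the monad identities hold).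
   Context: Composition is written $g\circ f$ (first $f$, then $g$). A Cartesian category is a category with chosen finite products: binary products $A\times B$ with projections $\pi_0:A\times B\to A$, $\pi_1:A\times B\to B$, pairing $\langle -,-\rangle$, $f\times g=\langle f\circ\pi_0,g\circ\pi_1\rangle$, and terminal object $\top$. A left additive category is a category in which each hom-set is a commutative monoid $(+,0)$ with $(f+g)\circ h=f\circ h+g\circ h$ and $0\circ f=0$. A map $k$ is additive if $k\circ(f+g)=k\circ f+k\circ g$ and $k\circ 0=0$. A Cartesian left additive category is a Cartesian category that is also left additive and whose projections are all additive. An infinitesimal extension $\varepsilon$ on a Cartesian left additive category $\mathbb{X}$ consists of functions $\varepsilon:\mathbb{X}(A,B)\to\mathbb{X}(A,B)$ for all $A,B$ such that [E.1] $\varepsilon(f+g)=\varepsilon(f)+\varepsilon(g)$, $\varepsilon(0)=0$; [E.2] $\varepsilon(g\circ f)=\varepsilon(g)\circ f$; [E.3] $\varepsilon(\pi_i)=\pi_i\circ\varepsilon(1_{A\times B})$ for $i=0,1$. A Cartesian difference category is a Cartesian left additive category with an infinitesimal extension $\varepsilon$ and a difference combinator $\boldsymbol\partial$, assigning to each $f:A\to B$ a map $\boldsymbol\partial[f]:A\times A\to B$, such that (for all suitable maps): [C∂.0] $f\circ(x+\varepsilon(y))=f\circ x+\varepsilon(\boldsymbol\partial[f]\circ\langle x,y\rangle)$; [C∂.1] $\boldsymbol\partial[f+g]=\boldsymbol\partial[f]+\boldsymbol\partial[g]$, $\boldsymbol\partial[0]=0$, $\boldsymbol\partial[\varepsilon(f)]=\varepsilon(\boldsymbol\partial[f])$;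 [C∂.2] $\boldsymbol\partial[f]\circ\langle x,y+z\rangle=\boldsymbol\partial[f]\circ\langle x,y\rangle+\boldsymbol\partial[f]\circ\langle x+\varepsilon(y),z\rangle$, $\boldsymbol\partial[f]\circ\langle x,0\rangle=0$; [C∂.3] $\boldsymbol\partial[1_A]=\pi_1$, $\boldsymbol\partial[\pi_0]=\pi_0\circ\pi_1$, $\boldsymbol\partial[\pi_1]=\pi_1\circ\pi_1$; [C∂.4] $\boldsymbol\partial[\langle f,g\rangle]=\langle\boldsymbol\partial[f],\boldsymbol\partial[g]\rangle$; [C∂.5] $\boldsymbol\partial[g\circ f]=\boldsymbol\partial[g]\circ\langle f\circ\pi_0,\boldsymbol\partial[f]\rangle$; [C∂.6] $\boldsymbol\partial[\boldsymbol\partial[f]]\circ\langle\langle x,y\rangle,\langle 0,z\rangle\rangle=\boldsymbol\partial[f]\circ\langle x+\varepsilon(y),z\rangle$; [C∂.7] $\boldsymbol\partial[\boldsymbol\partial[f]]\circ\langle\langle x,y\rangle,\langle z,0\rangle\rangle=\boldsymbol\partial[\boldsymbol\partial[f]]\circ\langle\langle x,z\rangle,\langle y,0\rangle\rangle$. *)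

(* Defs.v *)
Set Implicit Arguments.
Unset Strict Implicit.
Unset Printing Implicit Defensive.

Declare Scope cat_scope.
Delimit Scope cat_scope with cat.
Local Open Scope cat_scope.

Record category := Category {
  ob :> Type;
  hom : ob -> ob -> Type;
  idm : forall A, hom A A;
  comp : forall A B C, hom B C -> hom A B -> hom A C;
  comp1m : forall A B (f : hom A B), comp (idm B) f = f;
  compm1 : forall A B (f : hom A B), comp f (idm A) = f;
  compA : forall A B C D (h : hom C D) (g : hom B C) (f : hom A B),
    comp h (comp g f) = comp (comp h g) f
}.

Arguments hom {c} A B.
Arguments idm {c} A.
Arguments comp {c A B C} g f.

Notation "g ∘ f" := (comp g f) (at level 40, left associativity) : cat_scope.

(* Functor data only: the laws are part of what [is_monad] asserts. *)
Record prefunctor (C D : category) := Prefunctor {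
  fobj :> C -> D;
  fmap : forall A B : C, hom A B -> hom (fobj A) (fobj B)
}.

Arguments fmap {C D} F {A B} f : rename.

Definition prefunctor_id (C : category) : prefunctor C C :=
  {| fobj := fun A => A; fmap := fun _ _ f => f |}.

Definition prefunctor_comp (C D E : category)
    (G : prefunctor D E) (F : prefunctor C D) : prefunctor C E :=
  {| fobj := fun A => G (F A); fmap := fun _ _ f => fmap G (fmap F f) |}.

Record is_functor (C D : category) (F : prefunctor C D) : Prop := IsFunctor {
  fmap_id : forall A : C, fmap F (idm A) = idm (F A);
  fmap_comp : forall (A B E : C) (g : hom B E) (f : hom A B),
    fmap F (g ∘ f) = fmap F g ∘ fmap F f
}.

Definition is_natural (C D : category) (F G : prefunctor C D)
    (t : forall A : C, hom (F A) (G A)) : Prop :=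
  forall (A B : C) (f : hom A B), t B ∘ fmap F f = fmap G f ∘ t A.

Arguments is_natural {C D} F G t.

Record is_monad (C : category) (T : prefunctor C C)
    (mu : forall A : C, hom (T (T A)) (T A))
    (eta : forall A : C, hom A (T A)) : Prop := IsMonad {
  monad_functor : is_functor T;
  monad_mu_natural : is_natural (prefunctor_comp T T) T mu;
  monad_eta_natural : is_natural (prefunctor_id C) T eta;
  monad_assoc : forall A, mu A ∘ fmap T (mu A) = mu A ∘ mu (T A);
  monad_unit_l : forall A, mu A ∘ eta (T A) = idm (T A);
  monad_unit_r : forall A, mu A ∘ fmap T (eta A) = idm (T A)
}.

Arguments is_monad {C} T mu eta.

Class cartesian (C : category) := Cartesian {
  product : C -> C -> C;
  pi0 : forall {A B : C}, hom (product A B) A;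
  pi1 : forall {A B : C}, hom (product A B) B;
  pairing : forall {D A B : C}, hom D A -> hom D B -> hom D (product A B);
  pi0_pair : forall (D A B : C) (f : hom D A) (g : hom D B),
    pi0 ∘ pairing f g = f;
  pi1_pair : forall (D A B : C) (f : hom D A) (g : hom D B),
    pi1 ∘ pairing f g = g;
  pair_unique : forall (D A B : C) (f : hom D A) (g : hom D B)
      (h : hom D (product A B)),
    pi0 ∘ h = f -> pi1 ∘ h = g -> h = pairing f g;
  top : C;
  bang : forall A : C, hom A top;
  bang_unique : forall (A : C) (h : hom A top), h = bang A
}.

Notation "A × B" := (product A B) (at level 40, left associativity) : cat_scope.
Notation "⟨ f , g ⟩" := (pairing f g)
  (at level 0, f, g at level 99, format "⟨ f ,  g ⟩") : cat_scope.

(* Postcomposition need not preserve [add] and [zero]. *)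
Class left_additive (C : category) := LeftAdditive {
  add : forall {A B : C}, hom A B -> hom A B -> hom A B;
  zero : forall {A B : C}, hom A B;
  addA : forall (A B : C) (f g h : hom A B), add f (add g h) = add (add f g) h;
  addC : forall (A B : C) (f g : hom A B), add f g = add g f;
  add0 : forall (A B : C) (f : hom A B), add zero f = f;
  add_comp : forall (A B D : C) (f g : hom B D) (h : hom A B),
    add f g ∘ h = add (f ∘ h) (g ∘ h);
  zero_comp : forall (A B D : C) (f : hom A B),
    (zero : hom B D) ∘ f = zero
}.

Notation "f + g" := (add f g) : cat_scope.
Notation "0" := zero : cat_scope.

Definition additive (C : category) (aC : left_additive C) (A B : C)
    (k : hom A B) : Prop :=
  (forall (D : C) (f g : hom D A), k ∘ (f + g) = k ∘ f + k ∘ g) /\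
  (forall D : C, k ∘ (0 : hom D A) = 0).

Arguments additive {C aC A B} k.

Record cartesian_left_additive_category := CartesianLeftAdditiveCategory {
  clac_category :> category;
  #[global] clac_cartesian :: cartesian clac_category;
  #[global] clac_left_additive :: left_additive clac_category;
  pi0_additive : forall A B : clac_category, additive (pi0 (A := A) (B := B));
  pi1_additive : forall A B : clac_category, additive (pi1 (A := A) (B := B))
}.

Class infinitesimal_extension (X : cartesian_left_additive_category) :=
    InfinitesimalExtension {
  ε : forall {A B : X}, hom A B -> hom A B;
  ext_add : forall (A B : X) (f g : hom A B), ε (f + g) = ε f + ε g;
  ext_zero : forall A B : X, ε (0 : hom A B) = 0;
  ext_comp : forall (A B C : X) (g : hom B C) (f : hom A B),
    ε (g ∘ f) = ε g ∘ f;
  ext_pi0 : forall A B : X, ε (pi0 (A := A) (B := B)) = pi0 ∘ ε (idm (A × B));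
  ext_pi1 : forall A B : X, ε (pi1 (A := A) (B := B)) = pi1 ∘ ε (idm (A × B))
}.

Reserved Notation "∂[ f ]" (at level 0, f at level 99, format "∂[ f ]").

Class difference_combinator (X : cartesian_left_additive_category)
    (eX : infinitesimal_extension X) := DifferenceCombinator {
  diff : forall {A B : X}, hom A B -> hom (A × A) B
    where "∂[ f ]" := (diff f);
  diff_taylor : forall (A B C : X) (f : hom A B) (x y : hom C A),
    f ∘ (x + ε y) = f ∘ x + ε (∂[f] ∘ ⟨x, y⟩);
  diff_add : forall (A B : X) (f g : hom A B), ∂[f + g] = ∂[f] + ∂[g];
  diff_zero : forall A B : X, ∂[(0 : hom A B)] = 0;
  diff_ext : forall (A B : X) (f : hom A B), ∂[ε f] = ε ∂[f];
  diff_regular_add : forall (A B C : X) (f : hom A B) (x y z : hom C A),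
    ∂[f] ∘ ⟨x, y + z⟩ = ∂[f] ∘ ⟨x, y⟩ + ∂[f] ∘ ⟨x + ε y, z⟩;
  diff_regular_zero : forall (A B C : X) (f : hom A B) (x : hom C A),
    ∂[f] ∘ ⟨x, 0⟩ = 0;
  diff_id : forall A : X, ∂[idm A] = pi1;
  diff_pi0 : forall A B : X, ∂[pi0 (A := A) (B := B)] = pi0 ∘ pi1;
  diff_pi1 : forall A B : X, ∂[pi1 (A := A) (B := B)] = pi1 ∘ pi1;
  diff_pair : forall (A B C : X) (f : hom A B) (g : hom A C),
    ∂[⟨f, g⟩] = ⟨∂[f], ∂[g]⟩;
  diff_comp : forall (A B C : X) (g : hom B C) (f : hom A B),
    ∂[g ∘ f] = ∂[g] ∘ ⟨f ∘ pi0, ∂[f]⟩;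
  diff_linear : forall (A B C : X) (f : hom A B) (x y z : hom C A),
    ∂[∂[f]] ∘ ⟨⟨x, y⟩, ⟨0, z⟩⟩ = ∂[f] ∘ ⟨x + ε y, z⟩;
  diff_symmetry : forall (A B C : X) (f : hom A B) (x y z : hom C A),
    ∂[∂[f]] ∘ ⟨⟨x, y⟩, ⟨z, 0⟩⟩ = ∂[∂[f]] ∘ ⟨⟨x, z⟩, ⟨y, 0⟩⟩
}.

Notation "∂[ f ]" := (diff f) : cat_scope.

Record cartesian_difference_category := CartesianDifferenceCategory {
  cdc_clac :> cartesian_left_additive_category;
  #[global] cdc_ext :: infinitesimal_extension cdc_clac;
  #[global] cdc_diff :: difference_combinator cdc_ext
}.

Definition tangent (X : cartesian_difference_category) : prefunctor X X :=
  {| fobj := fun A => A × A; fmap := fun A B f => ⟨f ∘ pi0, ∂[f]⟩ |}.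

Definition tangent_eta (X : cartesian_difference_category) (A : X) :
    hom A (tangent X A) :=
  ⟨idm A, 0⟩.

Definition tangent_mu (X : cartesian_difference_category) (A : X) :
    hom (tangent X (tangent X A)) (tangent X A) :=
  let π00 := pi0 ∘ pi0 : hom ((A × A) × (A × A)) A in
  let π10 := pi1 ∘ pi0 : hom ((A × A) × (A × A)) A in
  let π01 := pi0 ∘ pi1 : hom ((A × A) × (A × A)) A in
  let π11 := pi1 ∘ pi1 : hom ((A × A) × (A × A)) A in
  ⟨π00, π10 + π01 + ε π11⟩.

(* Main.v *)
(** Evaluated at a point ⟨⟨a,b⟩,⟨c,d⟩⟩ of T²(A), naturality of μ reads
    ∂[f]⟨a, b+c+ε(d)⟩ = ∂[f]⟨a,b⟩ + ∂[f]⟨a,c⟩ + ε(∂[∂[f]]⟨⟨a,b⟩,⟨c,d⟩⟩).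
    By [C∂.0] for the map ∂[f], the first and last summands on the right add up
    to ∂[f]⟨a+ε(c), b+ε(d)⟩, and [C∂.2] absorbs the remaining one. Associativity
    rests on ∂[μ] = μ∘π₁, which holds because μ is built from projections, sums
    and ε. *)
Require Import Defs.
From Corelib Require Import ssreflect.

Set Implicit Arguments.
Unset Strict Implicit.

Local Open Scope cat_scope.

Section Cartesian.

Context {C : category} {cC : cartesian C}.

Lemma pair_comp (D E A B : C) (f : hom D A) (g : hom D B) (h : hom E D) :
  ⟨f, g⟩ ∘ h = ⟨f ∘ h, g ∘ h⟩.
Proof. by apply: pair_unique; rewrite compA ?pi0_pair ?pi1_pair. Qed.

Lemma pair_eta (D A B : C) (h : hom D (A × B)) : ⟨pi0 ∘ h, pi1 ∘ h⟩ = h.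
Proof. by symmetry; apply: pair_unique. Qed.

Lemma pair_pi (A B : C) : ⟨pi0, pi1⟩ = idm (A × B).
Proof. by rewrite -(pair_eta (idm _)) !compm1. Qed.

End Cartesian.

Section LeftAdditive.

Context {C : category} {aC : left_additive C}.

Lemma addr0 (A B : C) (f : hom A B) : f + 0 = f.
Proof. by rewrite addC add0. Qed.

Lemma addAC (A B : C) (f g h : hom A B) : f + g + h = f + h + g.
Proof. by rewrite -addA (addC g) addA. Qed.

End LeftAdditive.

Section InfinitesimalExtension.

Context {X : cartesian_left_additive_category} {eX : infinitesimal_extension X}.

Lemma pi0_add (D A B : X) (f g : hom D (A × B)) :
  pi0 ∘ (f + g) = pi0 ∘ f + pi0 ∘ g.
Proof. exact: (proj1 (pi0_additive A B)). Qed.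

Lemma pi1_add (D A B : X) (f g : hom D (A × B)) :
  pi1 ∘ (f + g) = pi1 ∘ f + pi1 ∘ g.
Proof. exact: (proj1 (pi1_additive A B)). Qed.

Lemma pi0_zero (D A B : X) : pi0 ∘ (0 : hom D (A × B)) = 0.
Proof. exact: (proj2 (pi0_additive A B)). Qed.

Lemma pi1_zero (D A B : X) : pi1 ∘ (0 : hom D (A × B)) = 0.
Proof. exact: (proj2 (pi1_additive A B)). Qed.

(** By [E.2], [ε h] equals [ε (idm _) ∘ h], which carries [E.3] from the projections themselves to
    every map into a product. *)
Lemma pi0_ext (D A B : X) (h : hom D (A × B)) : pi0 ∘ ε h = ε (pi0 ∘ h).
Proof. by rewrite -{1}(comp1m h) !ext_comp ext_pi0 compA. Qed.

Lemma pi1_ext (D A B : X) (h : hom D (A × B)) : pi1 ∘ ε h = ε (pi1 ∘ h).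
Proof. by rewrite -{1}(comp1m h) !ext_comp ext_pi1 compA. Qed.

Lemma pair_add_ext (D A B : X) (a c : hom D A) (b d : hom D B) :
  ⟨a, b⟩ + ε ⟨c, d⟩ = ⟨a + ε c, b + ε d⟩.
Proof.
by apply: pair_unique;
  rewrite ?pi0_add ?pi1_add ?pi0_ext ?pi1_ext ?pi0_pair ?pi1_pair.
Qed.

End InfinitesimalExtension.

Section TangentMonad.

Context {X : cartesian_difference_category}.

Lemma diff_tangent_sum (A B D : X) (f : hom A B) (a b c d : hom D A) :
  ∂[f] ∘ ⟨a, b + c + ε d⟩ =
  ∂[f] ∘ ⟨a, b⟩ + ∂[f] ∘ ⟨a, c⟩ + ε (∂[∂[f]] ∘ ⟨⟨a, b⟩, ⟨c, d⟩⟩).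
Proof.
(* [C∂.2] is used with increments [c] and [b + ε d]: its shifted base point [a + ε c] is exactly the
   one that [C∂.0] produces. *)
by rewrite (addAC (_ ∘ _)) -diff_taylor pair_add_ext (addC (_ ∘ _)) -diff_regular_add addA (addC c).
Qed.

Lemma diff_comp_pi0 (A B D : X) (f : hom A D) :
  ∂[f ∘ pi0 (B := B)] = ∂[f] ∘ ⟨pi0 ∘ pi0, pi0 ∘ pi1⟩.
Proof. by rewrite diff_comp diff_pi0. Qed.

Lemma diff_pi_comp (A B D : X) (h : hom D (A × B)) :
  ∂[pi0 ∘ h] = pi0 ∘ ∂[h] /\ ∂[pi1 ∘ h] = pi1 ∘ ∂[h].
Proof. by rewrite !diff_comp diff_pi0 diff_pi1 -!compA pi1_pair. Qed.

(** Reduces the laws for μ to componentwise identities between projections of a generalized element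
    [h]. *)
Lemma tangent_mu_comp (A D : X) (h : hom D (tangent X (tangent X A))) :
  tangent_mu A ∘ h =
  ⟨pi0 ∘ (pi0 ∘ h),
   pi1 ∘ (pi0 ∘ h) + pi0 ∘ (pi1 ∘ h) + ε (pi1 ∘ (pi1 ∘ h))⟩.
Proof. by rewrite /tangent_mu /= pair_comp !add_comp -ext_comp -!compA. Qed.

Lemma diff_tangent_mu (A : X) : ∂[tangent_mu A] = tangent_mu A ∘ pi1.
Proof.
rewrite tangent_mu_comp /tangent_mu diff_pair !diff_add diff_ext.
by rewrite !(proj1 (diff_pi_comp _)) !(proj2 (diff_pi_comp _)) diff_pi0 diff_pi1.
Qed.

Lemma tangent_functor : is_functor (tangent X).
Proof.
split=> [A|A B E g f] /=; first by rewrite comp1m diff_id pair_pi.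
by rewrite pair_comp -!compA pi0_pair diff_comp.
Qed.

Lemma tangent_mu_natural :
  is_natural (prefunctor_comp (tangent X) (tangent X)) (tangent X)
    (@tangent_mu X).
Proof.
move=> A B f; rewrite tangent_mu_comp /= pair_comp -compA.
rewrite !(pi0_pair, pi1_pair) diff_pair !(pi0_pair, pi1_pair) diff_comp_pi0.
rewrite pair_comp /tangent_mu -compA pi0_pair diff_tangent_sum.
(* Here a, b, c, d are the four projections π00, π10, π01, π11, so ⟨a, b⟩ collapses to [pi0] and
   ⟨⟨a, b⟩, ⟨c, d⟩⟩ to the identity. *)
by rewrite !pair_eta pair_pi compm1.
Qed.

Lemma tangent_eta_natural :
  is_natural (prefunctor_id X) (tangent X) (@tangent_eta X).
Proof.
move=> A B f; rewrite /tangent_eta /= !pair_comp comp1m zero_comp.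
by rewrite -compA pi0_pair compm1 diff_regular_zero.
Qed.

Lemma tangent_mu_assoc (A : X) :
  tangent_mu A ∘ fmap (tangent X) (tangent_mu A) =
  tangent_mu A ∘ tangent_mu (tangent X A).
Proof.
rewrite !tangent_mu_comp /= diff_tangent_mu !(pi0_pair, pi1_pair).
rewrite !tangent_mu_comp /tangent_mu /= !(pi0_pair, pi1_pair).
rewrite !(pi0_add, pi1_add) !(pi0_ext, pi1_ext) !ext_add.
(* In the second component both sides have the same seven summands, one for each triple projection
   except π000, with ε applied once less than the number of indices 1. Only their order differs. *)
rewrite !addA (addAC _ (ε (pi0 ∘ _)) (ε (pi1 ∘ (pi1 ∘ _)))).
rewrite (addAC _ (pi0 ∘ (pi0 ∘ _)) (ε (pi1 ∘ (pi1 ∘ _)))).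
by rewrite (addAC _ (ε (pi0 ∘ _)) (ε (pi1 ∘ (pi0 ∘ _)))).
Qed.

Lemma tangent_mu_unit_l (A : X) :
  tangent_mu A ∘ tangent_eta (tangent X A) = idm (tangent X A).
Proof.
rewrite tangent_mu_comp /tangent_eta /= !(pi0_pair, pi1_pair).
(* Projections and ε preserve 0, so of the three summands only π10 survives. *)
by rewrite !(pi0_zero, pi1_zero) ext_zero !addr0 !compm1 pair_pi.
Qed.

Lemma tangent_mu_unit_r (A : X) :
  tangent_mu A ∘ fmap (tangent X) (tangent_eta A) = idm (tangent X A).
Proof.
(* Since ∂[η] is ⟨[pi1], 0⟩, the surviving summand is now π01. *)
rewrite tangent_mu_comp /tangent_eta /= diff_pair diff_id diff_zero.
rewrite !(pi0_pair, pi1_pair) pair_comp !(pi0_pair, pi1_pair).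
by rewrite comp1m zero_comp ext_zero add0 addr0 pair_pi.
Qed.

End TangentMonad.

Theorem proposition6p3 (X : cartesian_difference_category) :
  is_monad (tangent X) (@tangent_mu X) (@tangent_eta X).
Proof.
split.
- exact: tangent_functor.
- exact: tangent_mu_natural.
- exact: tangent_eta_natural.
- exact: tangent_mu_assoc.
- exact: tangent_mu_unit_l.
- exact: tangent_mu_unit_r.
Qed.
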